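(* Let $k$ be a field. Let $(A_i)_{i\in I}$ be a filtered system of quadratic graded $k$-algebras with injective transition maps (graded $k$-algebra homomorphisms), such that each $A_i$ is of finite type and universally Koszul. Then $A:=\varinjlim_{i\in I}A_i$ is asymptotically universally Koszul.
   Context: A graded $k$-algebra $A=\bigoplus_{n\ge 0}A_n$ is connected if $A_0=k$. A connected graded $k$-algebra generated in degree $1$ is quadratic if $A\cong T(V)/\langle R\rangle$ as graded algebras, where $V=A_1$ (possibly infinite-dimensional) and $R\subseteq V\otimes_k V$ is a subspace. A quadratic algebra $A$ is of finite type if $\dim_k A_1<\infty$. Universal Koszulity: let $A$ be a quadratic algebra with $\dim_k A_1<\infty$. Let $\mathcal L(A)$ be the set of graded left ideals $I\subseteq A$ with $I=A I_1$ (generated in degree $1$). $A$ is universally Koszul if for every $I\in\mathcal L(A)$ and every $x\in A_1\setminus I_1$, the colon ideal $I:x=\{a\in A\mid ax\in I\}$ belongs to $\mathcal L(A)$. Asymptotic universal Koszulity: a connected graded $k$-algebra $A$ generated in degree $1$ is asymptotically universally Koszul if there exists a filtered system (under inclusion) of quadratic graded subalgebras $(A_i)_{i\in I}$ of $A$ such that (i) each $A_i$ is generated in degree $1$ with $\dim_k(A_i)_1<\infty$; (ii) each $A_i$ is universally Koszul; (iii) the natural map $\varinjlim_{i\in I}A_i\to A$ is an isomorphism of graded algebras; (iv) every finite-dimensional subspace of $A_1$ is contained in some $(A_i)_1$. *)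

(* Defs.v *)
From HB Require Import structures.
From mathcomp Require Import all_boot all_order all_algebra.

Set Implicit Arguments.
Unset Strict Implicit.
Unset Printing Implicit Defensive.

Import GRing.Theory.
Local Open Scope ring_scope.

(* Subsets are boolean predicates.  Under the classical axioms of             *)
(* mathcomp.classical.boolp these are all subsets of the type.                *)

(* A subspace of a module, and a subalgebra of an algebra, as types: MathComp *)
(* provides the closed predicates but no canonical type for them.             *)

Record submod (R : pzRingType) (V : lmodType R) (S : submodClosed V) :=
  Submod { submod_val : V; submod_valP : submod_val \in S }.

HB.instance Definition _ R V S := [isSub for @submod_val R V S].
HB.instance Definition _ R V S := [Choice of @submod R V S by <:].
HB.instance Definition _ R V S := [SubChoice_isSubLmodule of @submod R V S by <:].

Record subalg (R : pzRingType) (A : algType R) (S : subalgClosed A) :=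
  Subalg { subalg_val : A; subalg_valP : subalg_val \in S }.

HB.instance Definition _ R A S := [isSub for @subalg_val R A S].
HB.instance Definition _ R A S := [Choice of @subalg R A S by <:].
HB.instance Definition _ R A S := [SubChoice_isSubAlgebra of @subalg R A S by <:].

Fact subalg_val_linear R A S : linear (@subalg_val R A S).
Proof. exact: (linearP (\val : subalg S -> A)). Qed.

Fact subalg_val_monoid_morphism R A S : monoid_morphism (@subalg_val R A S).
Proof.
by split; [exact: (rmorph1 (\val : subalg S -> A))
          |exact: (rmorphM (\val : subalg S -> A))].
Qed.

HB.instance Definition _ (R : pzRingType) (A : algType R) (S : subalgClosed A) :=
  GRing.isLinear.Build R (subalg S) A _ _ (@subalg_val_linear R A S).
HB.instance Definition _ (R : pzRingType) (A : algType R) (S : subalgClosed A) :=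
  GRing.isMonoidMorphism.Build (subalg S) A _ (@subalg_val_monoid_morphism R A S).

Definition finite_dimensional (k : fieldType) (V : lmodType k)
    (U : submodClosed V) : Prop :=
  exists s : seq V, {subset s <= U} /\
    forall x, x \in U -> exists c : nat -> k, x = \sum_(i < size s) c i *: s`_i.

(* The last two conditions say that A is the direct sum of the A_n. *)
Definition is_grading (k : fieldType) (A : algType k)
    (part : nat -> submodClosed A) : Prop :=
  [/\ 1 \in part 0,
      forall m n x y, x \in part m -> y \in part n -> x * y \in part (m + n)%N,
      forall x, exists n (f : nat -> A),
        (forall i, f i \in part i) /\ x = \sum_(i < n) f i
    & forall n (f : nat -> A), (forall i, f i \in part i) ->
        \sum_(i < n) f i = 0 -> forall i, (i < n)%N -> f i = 0].

Record gradedAlg (k : fieldType) := GradedAlg {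
  galg :> algType k;
  gpart : nat -> submodClosed galg;
  gpartP : is_grading gpart }.

Record gradedHom (k : fieldType) (A B : gradedAlg k) := GradedHom {
  ghom :> {lrmorphism A -> B};
  ghomP : forall n x, x \in gpart A n -> ghom x \in gpart B n }.

(* S contains the homogeneous components of its elements. *)
Definition homogeneous (k : fieldType) (A : gradedAlg k) (S : {pred A}) : Prop :=
  forall n (f : nat -> A), (forall i, f i \in gpart A i) ->
    \sum_(i < n) f i \in S -> forall i, (i < n)%N -> f i \in S.

Definition connected (k : fieldType) (A : gradedAlg k) : Prop :=
  forall x, x \in gpart A 0 <-> exists c : k, x = c%:A.

Definition generated_in_degree1 (k : fieldType) (A : gradedAlg k) : Prop :=
  forall x : A, exists s : seq (k * seq A),
    (forall w, w \in s -> {subset w.2 <= gpart A 1}) /\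
    x = \sum_(w <- s) w.1 *: \prod_(y <- w.2) y.

Definition finite_type (k : fieldType) (A : gradedAlg k) : Prop :=
  finite_dimensional (gpart A 1).

(* The universal property makes T generated by iota(V), so the grading is     *)
(* determined by iota(V) being in degree 1: T_n is the span of the n-fold     *)
(* products of elements of iota(V), that is, the n-th tensor power of V.      *)
Definition is_tensor_algebra (k : fieldType) (V : lmodType k) (T : gradedAlg k)
    (iota : {linear V -> T}) : Prop :=
  [/\ forall v, iota v \in gpart T 1,
      forall (B : algType k) (f : {linear V -> B}),
        exists g : {lrmorphism T -> B}, forall v, g (iota v) = f v
    & forall (B : algType k) (g h : {lrmorphism T -> B}),
        (forall v, g (iota v) = h (iota v)) -> g =1 h].

Definition in_ideal_generated (A : nzRingType) (R : {pred A}) (x : A) : Prop :=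
  exists s : seq (A * A * A),
    (forall t, t \in s -> t.1.2 \in R) /\
    x = \sum_(t <- s) t.1.1 * t.1.2 * t.2.

(* pi exhibits A as the quotient of the tensor algebra T by the ideal <R>. *)
Definition quadratic (k : fieldType) (A : gradedAlg k) : Prop :=
  [/\ connected A, generated_in_degree1 A
    & exists (T : gradedAlg k) (iota : {linear submod (gpart A 1) -> T})
             (R : submodClosed T) (pi : gradedHom T A),
        [/\ is_tensor_algebra iota,
            {subset R <= gpart T 2},
            forall a, exists t, pi t = a
          & forall t, pi t = 0 <-> in_ideal_generated R t]].

Definition left_ideal (A : nzRingType) (I : {pred A}) : Prop :=
  [/\ 0 \in I, forall u v, u \in I -> v \in I -> u + v \in I
    & forall a u, u \in I -> a * u \in I].

(* The set L(A).  For a left ideal I, the last condition is I = A I_1. *)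
Definition gen1_left_ideal (k : fieldType) (A : gradedAlg k) (I : {pred A}) : Prop :=
  [/\ left_ideal I, homogeneous I
    & forall x, x \in I -> exists s : seq (A * A),
        (forall t, t \in s -> t.2 \in I /\ t.2 \in gpart A 1) /\
        x = \sum_(t <- s) t.1 * t.2].

Definition colon (A : nzRingType) (I : {pred A}) (x : A) : {pred A} :=
  [pred a | a * x \in I].

Definition universally_koszul (k : fieldType) (A : gradedAlg k) : Prop :=
  forall I : {pred A}, gen1_left_ideal I ->
  forall x, x \in gpart A 1 -> x \notin I -> gen1_left_ideal (colon I x).

Record directedSystem (k : fieldType) := DirectedSystem {
  ds_index : Type;
  ds_le : ds_index -> ds_index -> Prop;
  ds_refl : forall i, ds_le i i;
  ds_trans : forall i j l, ds_le i j -> ds_le j l -> ds_le i l;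
  ds_nonempty : exists i : ds_index, True;
  ds_directed : forall i j, exists l, ds_le i l /\ ds_le j l;
  ds_obj :> ds_index -> gradedAlg k;
  ds_map : forall i j, ds_le i j -> gradedHom (ds_obj i) (ds_obj j);
  ds_map_id : forall i (h : ds_le i i) x, ds_map h x = x;
  ds_map_comp : forall i j l (hij : ds_le i j) (hjl : ds_le j l) (hil : ds_le i l) x,
    ds_map hjl (ds_map hij x) = ds_map hil x }.

Definition is_cocone (k : fieldType) (D : directedSystem k) (L : gradedAlg k)
    (phi : forall i, gradedHom (D i) L) : Prop :=
  forall i j (h : ds_le i j) x, phi j (ds_map h x) = phi i x.

(* The direct limit in the category of graded algebras. *)
Definition is_direct_limit (k : fieldType) (D : directedSystem k) (L : gradedAlg k)
    (phi : forall i, gradedHom (D i) L) : Prop :=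
  is_cocone phi /\
  forall (B : gradedAlg k) (psi : forall i, gradedHom (D i) B), is_cocone psi ->
    (exists u : gradedHom L B, forall i x, u (phi i x) = psi i x) /\
    (forall u v : gradedHom L B,
       (forall i x, u (phi i x) = psi i x) ->
       (forall i x, v (phi i x) = psi i x) -> u =1 v).

Record gradedSubalg (k : fieldType) (A : gradedAlg k) := GradedSubalg {
  gsub :> subalgClosed A;
  gsub_homogeneous : homogeneous gsub }.

Section InducedGrading.
Variables (k : fieldType) (A : gradedAlg k) (S : gradedSubalg A).

Definition sub_part (n : nat) : {pred subalg S} :=
  [pred x | val x \in gpart A n].

Lemma sub_part_closed n : GRing.submod_closed (sub_part n).
Proof.
split; first by rewrite inE raddf0 rpred0.
by move=> a x y; rewrite !inE linearP => Hx Hy; rewrite rpredD ?rpredZ.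
Qed.

HB.instance Definition _ n :=
  GRing.isSubmodClosed.Build k (subalg S) (sub_part n) (sub_part_closed n).

Lemma sub_part_grading : is_grading (fun n => sub_part n : submodClosed _).
Proof.
case: (gpartP A) => A0 AM Asum Adir; split.
- by rewrite inE rmorph1.
- by move=> m n x y; rewrite !inE rmorphM; exact: AM.
- move=> x; have [n [f [fP xE]]] := Asum (val x).
  have fS i : (i < n)%N -> f i \in (S : {pred _}).
    by apply: gsub_homogeneous => //; rewrite -xE; exact: valP.
  exists n, (fun i => insubd (0 : subalg S) (f i)); split.
    move=> i; rewrite inE val_insubd; case: ifP => // _.
    by rewrite raddf0 rpred0.
  apply: val_inj; rewrite raddf_sum xE; apply: eq_bigr => i _.
  by rewrite /= val_insubd fS.
- move=> n f fP f0 i ltin; apply: val_inj; rewrite raddf0.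
  apply: (Adir n (fun i => val (f i))) => //.
  by rewrite -raddf_sum f0 raddf0.
Qed.

Definition sub_graded : gradedAlg k := GradedAlg sub_part_grading.

Definition sub_inj : gradedHom sub_graded A :=
  @GradedHom k sub_graded A (@subalg_val k A S : {lrmorphism subalg S -> A}) (fun n x => id).

End InducedGrading.

Coercion sub_graded : gradedSubalg >-> gradedAlg.

Section Inclusion.
Variables (k : fieldType) (A : gradedAlg k) (S S' : gradedSubalg A).
Hypothesis sSS' : {subset S <= S'}.

Definition incl (x : subalg S) : subalg S' := Subalg (sSS' (subalg_valP x)).

Fact incl_linear : linear incl.
Proof. by move=> a x y; apply: val_inj; rewrite !(linearP (\val : subalg _ -> A)). Qed.

Fact incl_monoid_morphism : monoid_morphism incl.
Proof.
by split=> [|x y]; apply: val_inj;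
  rewrite ?(rmorphM (\val : subalg _ -> A)) ?(rmorph1 (\val : subalg _ -> A)).
Qed.

HB.instance Definition _ := GRing.isLinear.Build k (subalg S) (subalg S') _ incl incl_linear.
HB.instance Definition _ :=
  GRing.isMonoidMorphism.Build (subalg S) (subalg S') incl incl_monoid_morphism.

Definition incl_hom : gradedHom S S' :=
  @GradedHom k S S' (incl : {lrmorphism subalg S -> subalg S'}) (fun n x => id).

End Inclusion.

Section InclusionSystem.
Variables (k : fieldType) (A : gradedAlg k) (J : Type) (B : J -> gradedSubalg A).
Hypothesis J_nonempty : exists j : J, True.
Hypothesis J_directed :
  forall i j, exists l, {subset B i <= B l} /\ {subset B j <= B l}.

Definition inclusion_system : directedSystem k.
Proof.
refine (@DirectedSystem k J (fun i j => {subset B i <= B j}) _ _ J_nonempty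
  J_directed (fun j => B j) (fun i j h => incl_hom h) _ _).
- by move=> i x.
- by move=> i j l hij hjl x /hij /hjl.
- by move=> i h x; apply: val_inj.
- by move=> i j l hij hjl hil x; apply: val_inj.
Defined.

End InclusionSystem.

(* The natural map from the direct limit of the B j to A is an isomorphism    *)
(* exactly when A with the inclusions of the B j is a direct limit.           *)
Definition asymptotically_universally_koszul (k : fieldType) (A : gradedAlg k) : Prop :=
  [/\ connected A, generated_in_degree1 A
    & exists (J : Type) (B : J -> gradedSubalg A) (J_nonempty : exists j : J, True)
        (J_directed : forall i j, exists l, {subset B i <= B l} /\ {subset B j <= B l}),
        [/\ forall j, quadratic (B j) /\ finite_type (B j),
            forall j, universally_koszul (B j),
            @is_direct_limit k (inclusion_system J_nonempty J_directed) A
              (fun j => sub_inj (B j))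
          & forall W : submodClosed A, finite_dimensional W ->
              {subset W <= gpart A 1} -> exists j,
                forall x, x \in W -> exists2 y : B j, y \in gpart (B j) 1 & sub_inj (B j) y = x]].

(* Main.v *)
(* The transition maps being injective, so are the maps phi i : D i -> A, and  *)
(* the D i are isomorphic to their images, which are nested graded             *)
(* subalgebras of A.  Hence the images inherit quadraticity, finite type and   *)
(* universal Koszulity; they exhaust A, so each finite subset of A lies in one *)
(* of them, and A is again the direct limit of its subsystem of images.        *)
(* Injectivity of phi i and exhaustion of A cannot be read off the universal   *)
(* property alone: both come from comparing A with an explicit direct limit,   *)
(* the algebra colim of germs, equality in which means equality at some stage. *)

Require Import Defs.
From HB Require Import structures.
From mathcomp Require Import all_boot all_order all_algebra.
From mathcomp Require Import boolp.

Set Implicit Arguments.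
Unset Strict Implicit.
Unset Printing Implicit Defensive.

Import GRing.Theory.
Local Open Scope ring_scope.
Local Open Scope quotient_scope.

(** * The direct limit of a directed system *)

(** Two facts about the limit cone carry the proof: every element of [A] comes from some [D i]
    ([limit_surj]), and every [phi i] is injective ([limit_inj]). Given these, [D i] is isomorphic
    to its image as a graded algebra, and quadraticity, finite type and universal Koszulity are
    invariant under such isomorphisms ([quadratic_iso], [finite_type_iso],
    [universally_koszul_iso]). Directedness puts a finite spanning set of a subspace of [A_1] into a
    single image. Cocones on the images and cocones on the [D i] determine each other, so [A] is
    also the limit of the images ([image_limit]).

    Both facts follow from the map [u] from [A] to [colim] given by the universal property. If
    [phi i x = 0], the germ of [x] is zero, so [x] dies at a later stage; injective transition maps
    force [x = 0]. By uniqueness, [u] followed by the map from [colim] back to [A] is the identity,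
    and every element of [colim] is a germ. *)

Section Colimit.
Variables (k : fieldType) (D : directedSystem k).

(* {classic _} supplies the choice structure that algType demands of the       *)
(* quotient below; ds_index D has none of its own.                             *)
Definition germ : choiceType := {classic {i : ds_index D & D i}}.

Definition same_germ (s t : germ) : bool :=
  `[< exists l (h : ds_le (tag s) l) (h' : ds_le (tag t) l),
        ds_map h (tagged s) = ds_map h' (tagged t) >].

Lemma same_germP (i j : ds_index D) (x : D i) (y : D j) :
  reflect (exists l (h : ds_le i l) (h' : ds_le j l), ds_map h x = ds_map h' y)
          (same_germ (Tagged (fun i => D i : Type) x) (Tagged (fun i => D i : Type) y)).
Proof. exact: asboolP. Qed.

(** Different proofs of [ds_le i j] could a priori index different maps; composing with the identity
    of [D i] identifies them. *)
Lemma ds_map_irr i j (h h' : @ds_le k D i j) x : ds_map h x = ds_map h' x.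
Proof.
by rewrite -(ds_map_comp (ds_refl i) h h') ds_map_id.
Qed.

Lemma same_germ_refl : reflexive same_germ.
Proof. by case=> i x; apply/same_germP; exists i, (ds_refl i), (ds_refl i). Qed.

Lemma same_germ_sym : symmetric same_germ.
Proof.
by case=> i x [j y]; apply/same_germP/same_germP=> -[l [h [h' e]]]; exists l, h', h.
Qed.

(** At a stage beyond both witnesses, the middle element [y] has a single image, whichever way it
    travels. *)
Lemma same_germ_trans : transitive same_germ.
Proof.
case=> j y [i x] [l z] /same_germP [m [h [h' e]]] /same_germP [n [g [g' e']]].
apply/same_germP; have [p [hp gp]] := ds_directed m n.
exists p, (ds_trans h hp), (ds_trans g' gp).
rewrite -(ds_map_comp h hp) e -(ds_map_comp g' gp) -e'.
by rewrite (ds_map_comp h' hp (ds_trans h' hp)) (ds_map_comp g gp (ds_trans h' hp)).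
Qed.

Canonical same_germ_equiv := EquivRel same_germ same_germ_refl same_germ_sym same_germ_trans.

Definition colim := {eq_quot same_germ_equiv}.
HB.instance Definition _ := Choice.on colim.

Definition colim_in (i : ds_index D) (x : D i) : colim :=
  \pi_colim (Tagged (fun i => D i : Type) x : germ).

Lemma colim_in_eq i j (x : D i) (y : D j) :
  colim_in x = colim_in y <->
  exists l (h : ds_le i l) (h' : ds_le j l), ds_map h x = ds_map h' y.
Proof.
split=> [/eqmodP/same_germP //|exy].
by apply/eqmodP/same_germP.
Qed.

Lemma colim_in_map i j (h : ds_le i j) (x : D i) : colim_in (ds_map h x) = colim_in x.
Proof.
by apply/colim_in_eq; exists j, (ds_refl j), h; rewrite ds_map_id.
Qed.

Lemma colim_in_surj (b : colim) : exists i (x : D i), b = colim_in x.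
Proof. by elim/quotW: b => -[i x]; exists i, x. Qed.

(** Moving finitely many germs to one stage reduces each algebra axiom of [colim] to the same axiom
    in a single [D i]. *)
Lemma colim_in_surj2 (b c : colim) :
  exists i (x y : D i), b = colim_in x /\ c = colim_in y.
Proof.
have [i [x ->]] := colim_in_surj b; have [j [y ->]] := colim_in_surj c.
have [l [h h']] := ds_directed i j.
by exists l, (ds_map h x), (ds_map h' y); rewrite !colim_in_map.
Qed.

Lemma colim_in_surj3 (b c d : colim) :
  exists i (x y z : D i), [/\ b = colim_in x, c = colim_in y & d = colim_in z].
Proof.
have [i [x [y [-> ->]]]] := colim_in_surj2 b c; have [j [z ->]] := colim_in_surj d.
have [l [h h']] := ds_directed i j.
by exists l, (ds_map h x), (ds_map h y), (ds_map h' z); rewrite !colim_in_map.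
Qed.

Lemma colim_in_eq1 i (x y : D i) :
  colim_in x = colim_in y <-> exists l (h : ds_le i l), ds_map h x = ds_map h y.
Proof.
split=> [/colim_in_eq [l [h [h' e]]]|[l [h e]]].
  by exists l, h; rewrite e; apply: ds_map_irr.
by apply/colim_in_eq; exists l, h, h.
Qed.

(** * The algebra structure on germs *)

Section Lift.
Variable f : forall i, D i -> D i -> D i.
Hypothesis f_nat : forall i j (h : @ds_le k D i j) x y,
  ds_map h (f x y) = f (ds_map h x) (ds_map h y).

Definition colim_lift2 (b c : colim) : colim :=
  let r := cid (colim_in_surj2 b c) in
  let x := cid (projT2 r) in
  colim_in (f (projT1 x) (projT1 (cid (projT2 x)))).

Lemma colim_lift2E i (x y : D i) :
  colim_lift2 (colim_in x) (colim_in y) = colim_in (f x y).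
Proof.
rewrite /colim_lift2; case: cid => j /= r; case: cid => x' /= r'; case: cid => y' /= {r r'}.
case=> /colim_in_eq [l [h [h' ex]]] /colim_in_eq [m [g [g' ey]]].
(* A stage beyond [l], where the first arguments agree, and [m], where the second ones do. *)
have [n [hn gn]] := ds_directed l m; have hi := ds_trans h hn; have hj := ds_trans h' hn.
apply/colim_in_eq; exists n, hj, hi; rewrite !f_nat.
rewrite -(ds_map_comp h' hn hj x') -ex (ds_map_comp h hn hi).
by rewrite -(ds_map_comp g' gn hj y') -ey (ds_map_comp g gn hi).
Qed.

End Lift.

Definition colim_i0 : ds_index D := projT1 (cid (ds_nonempty D)).

Definition colim_add := colim_lift2 (fun i => +%R).
Definition colim_mul := colim_lift2 (fun i => *%R).
(** The unary operations reuse the binary lift on the pair [b], [b] and ignore the second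
    argument. *)
Definition colim_opp := fun b => colim_lift2 (fun i x _ => - x) b b.
Definition colim_scale (c : k) := fun b => colim_lift2 (fun i x _ => c *: x) b b.
Definition colim_zero : colim := colim_in (0 : D colim_i0).
Definition colim_one : colim := colim_in (1 : D colim_i0).

Lemma colim_addE i (x y : D i) :
  colim_add (colim_in x) (colim_in y) = colim_in (x + y).
Proof. by apply: colim_lift2E => *; exact: raddfD. Qed.

Lemma colim_mulE i (x y : D i) :
  colim_mul (colim_in x) (colim_in y) = colim_in (x * y).
Proof. by apply: colim_lift2E => *; exact: rmorphM. Qed.

Lemma colim_oppE i (x : D i) : colim_opp (colim_in x) = colim_in (- x).
Proof. by apply: (colim_lift2E (f := fun i x _ => - x)) => *; exact: raddfN. Qed.

Lemma colim_scaleE c i (x : D i) : colim_scale c (colim_in x) = colim_in (c *: x).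
Proof. by apply: (colim_lift2E (f := fun i x _ => c *: x)) => *; exact: linearZ. Qed.

Lemma colim_zeroE i : colim_zero = colim_in (0 : D i).
Proof.
have [l [h h']] := ds_directed colim_i0 i.
by rewrite /colim_zero -(colim_in_map h) -(colim_in_map h') !raddf0.
Qed.

Lemma colim_oneE i : colim_one = colim_in (1 : D i).
Proof.
have [l [h h']] := ds_directed colim_i0 i.
by rewrite /colim_one -(colim_in_map h) -(colim_in_map h') !rmorph1.
Qed.

Fact colim_addA : associative colim_add.
Proof.
by move=> b c d; have [i [x [y [z [-> -> ->]]]]] := colim_in_surj3 b c d; rewrite !colim_addE addrA.
Qed.

Fact colim_addC : commutative colim_add.
Proof.
by move=> b c; have [i [x [y [-> ->]]]] := colim_in_surj2 b c; rewrite !colim_addE addrC.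
Qed.

Fact colim_add0 : left_id colim_zero colim_add.
Proof.
by move=> b; have [i [x ->]] := colim_in_surj b; rewrite (colim_zeroE i) colim_addE add0r.
Qed.

Fact colim_addN : left_inverse colim_zero colim_opp colim_add.
Proof.
move=> b; have [i [x ->]] := colim_in_surj b.
by rewrite (colim_zeroE i) colim_oppE colim_addE addNr.
Qed.

HB.instance Definition _ :=
  GRing.isZmodule.Build colim colim_addA colim_addC colim_add0 colim_addN.

Fact colim_mulA : associative colim_mul.
Proof.
by move=> b c d; have [i [x [y [z [-> -> ->]]]]] := colim_in_surj3 b c d; rewrite !colim_mulE mulrA.
Qed.

Fact colim_mul1 : left_id colim_one colim_mul.
Proof.
by move=> b; have [i [x ->]] := colim_in_surj b; rewrite (colim_oneE i) colim_mulE mul1r.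
Qed.

Fact colim_mulr1 : right_id colim_one colim_mul.
Proof.
by move=> b; have [i [x ->]] := colim_in_surj b; rewrite (colim_oneE i) colim_mulE mulr1.
Qed.

Fact colim_mulDl : left_distributive colim_mul +%R.
Proof.
move=> b c d; have [i [x [y [z [-> -> ->]]]]] := colim_in_surj3 b c d.
by rewrite [colim_in x + _]colim_addE !colim_mulE [RHS]colim_addE mulrDl.
Qed.

Fact colim_mulDr : right_distributive colim_mul +%R.
Proof.
move=> b c d; have [i [x [y [z [-> -> ->]]]]] := colim_in_surj3 b c d.
by rewrite [colim_in y + _]colim_addE !colim_mulE [RHS]colim_addE mulrDr.
Qed.

(** An equality of germs already holds in some [D l], which is a nonzero ring. *)
Fact colim_one_neq0 : colim_one != 0.
Proof.
apply/eqP=> /colim_in_eq1 [l [h]]; rewrite rmorph1 raddf0 => /eqP.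
by rewrite oner_eq0.
Qed.

HB.instance Definition _ := GRing.Zmodule_isNzRing.Build colim
  colim_mulA colim_mul1 colim_mulr1 colim_mulDl colim_mulDr colim_one_neq0.

Fact colim_scaleA a b v : colim_scale a (colim_scale b v) = colim_scale (a * b) v.
Proof. by have [i [x ->]] := colim_in_surj v; rewrite !colim_scaleE scalerA. Qed.

Fact colim_scale1 : left_id 1 colim_scale.
Proof. by move=> v; have [i [x ->]] := colim_in_surj v; rewrite colim_scaleE scale1r. Qed.

Fact colim_scaleDr : right_distributive colim_scale +%R.
Proof.
move=> a b c; have [i [x [y [-> ->]]]] := colim_in_surj2 b c.
by rewrite [colim_in x + _]colim_addE !colim_scaleE [RHS]colim_addE scalerDr.
Qed.

Fact colim_scaleDl v : {morph colim_scale^~ v : a b / a + b}.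
Proof.
move=> a b; have [i [x ->]] := colim_in_surj v.
by rewrite !colim_scaleE [RHS]colim_addE scalerDl.
Qed.

HB.instance Definition _ := GRing.Zmodule_isLmodule.Build k colim
  colim_scaleA colim_scale1 colim_scaleDr colim_scaleDl.

Fact colim_scaleAl (a : k) (u v : colim) : a *: (u * v) = a *: u * v.
Proof.
have [i [x [y [-> ->]]]] := colim_in_surj2 u v.
rewrite [_ * _]colim_mulE [LHS]colim_scaleE [a *: colim_in _]colim_scaleE.
by rewrite [RHS]colim_mulE scalerAl.
Qed.

HB.instance Definition _ := GRing.Lmodule_isLalgebra.Build k colim colim_scaleAl.

Fact colim_scaleAr (a : k) (u v : colim) : a *: (u * v) = u * (a *: v).
Proof.
have [i [x [y [-> ->]]]] := colim_in_surj2 u v.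
rewrite [_ * _]colim_mulE [LHS]colim_scaleE [a *: colim_in _]colim_scaleE.
by rewrite [RHS]colim_mulE scalerAr.
Qed.

HB.instance Definition _ := GRing.Lalgebra_isAlgebra.Build k colim colim_scaleAr.

Fact colim_in_linear i : linear (@colim_in i).
Proof. by move=> a x y; rewrite [a *: colim_in _]colim_scaleE [RHS]colim_addE. Qed.

Fact colim_in_monoid_morphism i : monoid_morphism (@colim_in i).
Proof. by split=> [|x y]; [rewrite -colim_oneE | rewrite [RHS]colim_mulE]. Qed.

HB.instance Definition _ i := GRing.isLinear.Build k (D i) colim _ _ (@colim_in_linear i).
HB.instance Definition _ i :=
  GRing.isMonoidMorphism.Build (D i) colim _ (@colim_in_monoid_morphism i).

Lemma colim_in_eq0 i (x : D i) :
  colim_in x = 0 <-> exists l (h : ds_le i l), ds_map h x = 0.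
Proof.
rewrite -(raddf0 (@colim_in i)) colim_in_eq1.
by split=> -[l [h e]]; exists l, h; move: e; rewrite raddf0.
Qed.

(** * The grading of the colimit *)

Definition colim_part (n : nat) : {pred colim} :=
  [pred b | `[< exists i, exists2 x : D i, x \in gpart (D i) n & b = colim_in x >]].

Lemma colim_partP n b : reflect
  (exists i, exists2 x : D i, x \in gpart (D i) n & b = colim_in x)
  (b \in colim_part n).
Proof. exact: asboolP. Qed.

Lemma colim_in_part i n (x : D i) : x \in gpart (D i) n -> colim_in x \in colim_part n.
Proof. by move=> xn; apply/colim_partP; exists i, x. Qed.

(** Lifts the first [n] terms to one stage without changing degrees. The degree function [m] is
    constant for linear combinations, takes two values for products, and is the identity for
    decompositions into components. *)
Lemma colim_part_family n (m : nat -> nat) (f : nat -> colim) :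
  (forall i, f i \in colim_part (m i)) ->
  exists l (g : nat -> D l), (forall i, g i \in gpart (D l) (m i)) /\
    forall i, (i < n)%N -> f i = colim_in (g i).
Proof.
move=> fP; elim: n => [|n [l [g [gm gP]]]].
  by exists colim_i0, (fun=> 0); split=> // i; exact: rpred0.
have /colim_partP [j [x xn fE]] := fP n.
have [p [h h']] := ds_directed l j.
exists p, (fun i => if i == n then ds_map h' x else ds_map h (g i)); split=> i.
  by case: eqP => [->|_]; exact: ghomP.
by rewrite ltnS leq_eqVlt; case: eqP => [->|_ /= /gP ->]; rewrite colim_in_map.
Qed.

Lemma colim_part_closed n : GRing.submod_closed (colim_part n).
Proof.
split; first by rewrite -(raddf0 (@colim_in colim_i0)) colim_in_part // rpred0.
move=> a b c bn cn.
have [|l [g [gm gP]]] := @colim_part_family 2 (fun=> n) (fun i => if i is 0 then b else c).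
  by case.
by rewrite (gP 0%N) ?(gP 1%N) // -linearP colim_in_part // rpredD ?rpredZ ?gm.
Qed.

HB.instance Definition _ n :=
  GRing.isSubmodClosed.Build k colim (colim_part n) (colim_part_closed n).

Lemma colim_part_grading : is_grading (fun n => colim_part n : submodClosed _).
Proof.
split.
- rewrite -(rmorph1 (@colim_in colim_i0)) colim_in_part //.
  by case: (gpartP (D colim_i0)).
- move=> m n b c bm cn.
  have [|l [g [gm gP]]] := @colim_part_family 2 (fun i => if i is 0 then m else n)
    (fun i => if i is 0 then b else c); first by case.
  rewrite (gP 0%N) ?(gP 1%N) // -rmorphM colim_in_part //.
  by case: (gpartP (D l)) => _ H _ _; exact: H (gm 0%N) (gm 1%N).
- move=> b; have [i [x ->]] := colim_in_surj b.
  case: (gpartP (D i)) => _ _ /(_ x) [n [f [fP ->]]] _.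
  by exists n, (fun j => colim_in (f j)); rewrite raddf_sum; split=> // j; exact: colim_in_part.
- move=> n f fP f0 i ltin.
  have [l [g [gm gP]]] := @colim_part_family n id f fP.
  (* The sum of the lifts may vanish only at a stage [m] later than [l]; directness of the grading
     is applied in [D m]. *)
  have /colim_in_eq0 [m [h]] : colim_in (\sum_(j < n) g j) = 0.
    by rewrite raddf_sum -[RHS]f0; apply: eq_bigr => j _; rewrite (gP j).
  rewrite raddf_sum /= => h0; rewrite (gP i ltin); apply/colim_in_eq0; exists m, h.
  case: (gpartP (D m)) => _ _ _ /(_ n (fun j => ds_map h (g j))); apply=> //.
  by move=> j; exact: ghomP.
Qed.

Definition colim_graded : gradedAlg k := GradedAlg colim_part_grading.

Definition colim_hom i : gradedHom (D i) colim_graded :=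
  @GradedHom k (D i) colim_graded (@colim_in i : {lrmorphism D i -> colim}) (@colim_in_part i).

(** * Maps out of the colimit *)

Section Descent.
Variables (B : gradedAlg k) (psi : forall i, gradedHom (D i) B).
Hypothesis psi_cocone : is_cocone psi.

Definition colim_desc (b : colim) : B :=
  let r := cid (colim_in_surj b) in psi (projT1 r) (projT1 (cid (projT2 r))).

Lemma colim_descE i (x : D i) : colim_desc (colim_in x) = psi i x.
Proof.
rewrite /colim_desc; case: cid => j /= r; case: cid => y /= {r}.
move=> /colim_in_eq [l [h [h' e]]].
by rewrite -(psi_cocone h) e psi_cocone.
Qed.

Fact colim_desc_linear : linear colim_desc.
Proof.
move=> a b c; have [i [x [y [-> ->]]]] := colim_in_surj2 b c.
by rewrite -linearP !colim_descE linearP.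
Qed.

Fact colim_desc_monoid_morphism : monoid_morphism colim_desc.
Proof.
split=> [|b c]; first by rewrite -(rmorph1 (@colim_in colim_i0)) colim_descE rmorph1.
have [i [x [y [-> ->]]]] := colim_in_surj2 b c.
by rewrite -rmorphM !colim_descE rmorphM.
Qed.

HB.instance Definition _ := GRing.isLinear.Build k colim B _ colim_desc colim_desc_linear.
HB.instance Definition _ :=
  GRing.isMonoidMorphism.Build colim B colim_desc colim_desc_monoid_morphism.

Fact colim_desc_part n b : b \in gpart colim_graded n -> colim_desc b \in gpart B n.
Proof. by move=> /colim_partP [i [x xn ->]]; rewrite colim_descE; exact: ghomP. Qed.

Definition colim_desc_hom : gradedHom colim_graded B :=
  @GradedHom k colim_graded B (colim_desc : {lrmorphism colim -> B}) colim_desc_part.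

End Descent.

End Colimit.

(** * Comparison of an arbitrary direct limit with the colimit of germs *)

Definition comp_hom (k : fieldType) (A B C : gradedAlg k)
    (g : gradedHom B C) (f : gradedHom A B) : gradedHom A C :=
  @GradedHom k A C (g \o f : {lrmorphism A -> C}) (fun n x xn => ghomP g (ghomP f xn)).

Definition id_hom (k : fieldType) (A : gradedAlg k) : gradedHom A A :=
  @GradedHom k A A (idfun : {lrmorphism A -> A}) (fun n x xn => xn).

Section DirectLimit.
Variables (k : fieldType) (D : directedSystem k) (A : gradedAlg k).
Variable phi : forall i : ds_index D, gradedHom (D i) A.
Hypothesis A_limit : is_direct_limit phi.

(** The universal map from [A] to [colim] sends [phi i x] to the germ of [x], and a zero germ
    vanishes at a later stage. *)
Lemma limit_ker i (x : D i) : phi i x = 0 -> exists j (h : ds_le i j), ds_map h x = 0.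
Proof.
have [_ /(_ (colim_graded D) (@colim_hom k D))[]] := A_limit.
  by move=> j l h y; exact: colim_in_map.
move=> [u uE] _ x0; apply/colim_in_eq0.
by have := uE i x; rewrite x0 raddf0.
Qed.

(** The composite from [A] through [colim] back to [A] fixes every [phi i x], hence is the identity
    by uniqueness; so [a] is the image of the germ [u a]. *)
Lemma limit_surj a : exists i (x : D i), phi i x = a.
Proof.
have [phi_cocone A_univ] := A_limit.
have [|[u uE] _] := A_univ _ (@colim_hom k D).
  by move=> j l h y; exact: colim_in_map.
have [i [x ux]] := colim_in_surj (u a); exists i, x.
rewrite -(colim_descE phi_cocone) -ux.
have [_ /(_ (comp_hom (colim_desc_hom phi_cocone) u) (id_hom A))] := A_univ _ _ phi_cocone.
by apply=> // j y /=; rewrite uE /= colim_descE.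
Qed.

End DirectLimit.

(** * Images and isomorphisms of graded algebras *)

(** Both families are padded with zeros to length [n + m], and directness is applied to their
    difference. The conditionals discard the terms beyond each sum. *)
Lemma graded_parts_uniq (k : fieldType) (A : gradedAlg k) n m (f g : nat -> A) :
  (forall i, f i \in gpart A i) -> (forall i, g i \in gpart A i) ->
  \sum_(i < n) f i = \sum_(i < m) g i ->
  forall i, (if (i < n)%N then f i else 0) = (if (i < m)%N then g i else 0).
Proof.
move=> fP gP efg.
pose F p (e : nat -> A) i := if (i < p)%N then e i else 0.
have FP p e : (forall i, e i \in gpart A i) -> forall i, F p e i \in gpart A i.
  by move=> eP i; rewrite /F; case: ifP => // _; exact: rpred0.
have FE p e : (p <= n + m)%N -> \sum_(i < n + m) F p e i = \sum_(i < p) e i.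
  by move=> le_p; rewrite -big_mkcond /= -big_ord_widen.
move=> i; case: (ltnP i (n + m)) => [lt_i|le_i]; last first.
  by rewrite !ltnNge (leq_trans (leq_addr m n) le_i) (leq_trans (leq_addl n m) le_i).
apply/eqP; rewrite -subr_eq0; apply/eqP.
case: (gpartP A) => _ _ _ /(_ (n + m)%N (fun i => F n f i - F m g i)); apply=> //.
  by move=> j; rewrite -scaleN1r rpredD ?rpredZ ?FP.
by rewrite big_split /= sumrN !FE ?leq_addr ?leq_addl // efg subrr.
Qed.

Section GradedHom.
Variables (k : fieldType) (A B : gradedAlg k) (f : gradedHom A B).

(** The image of a component of [x] is a component of [f x]; outside degree [n] it is zero, and
    injectivity kills the component itself. *)
Lemma inj_hom_part n x : injective f -> f x \in gpart B n -> x \in gpart A n.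
Proof.
move=> f_inj fx.
case: (gpartP A) => _ _ /(_ x) [m [e [eP ex]]] _.
rewrite ex; apply: rpred_sum => -[i /= lt_im] _.
have [<-//|ne_in] := eqVneq i n; suff -> : e i = 0 by exact: rpred0.
apply: f_inj; rewrite raddf0.
(* The decomposition of [f x] into one nonzero term at most; length [n.+1] lets the index [n]
   occur. *)
have := @graded_parts_uniq k B m n.+1 (fun i => f (e i))
  (fun i => if i == n then f x else 0).
rewrite -raddf_sum -ex big_ord_recr /= eqxx big1 ?add0r; last first.
  by move=> j _; rewrite ltn_eqF.
move=> /(_ (fun j => ghomP f (eP j))) /(_ _ erefl i).
rewrite lt_im (negPf ne_in) if_same; apply=> j.
by case: eqP => [->//|_]; exact: rpred0.
Qed.

Definition hom_image : {pred B} := [pred b | `[< exists a, f a = b >]].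

Lemma hom_imageP b : reflect (exists a, f a = b) (b \in hom_image).
Proof. exact: asboolP. Qed.

Lemma mem_hom_image a : f a \in hom_image.
Proof. by apply/hom_imageP; exists a. Qed.

Lemma hom_image_closed : GRing.subalg_closed hom_image.
Proof.
split=> [|c _ _ /hom_imageP [x <-] /hom_imageP [y <-]|_ _ /hom_imageP [x <-] /hom_imageP [y <-]].
- by rewrite -(rmorph1 f) mem_hom_image.
- by rewrite -linearP mem_hom_image.
- by rewrite -rmorphM mem_hom_image.
Qed.

HB.instance Definition _ := GRing.isSubalgClosed.Build k B hom_image hom_image_closed.

(** By uniqueness of components, those of [f a] are the images of those of [a]. *)
Lemma hom_image_homogeneous : homogeneous hom_image.
Proof.
move=> n g gP /hom_imageP [a fa] i lt_in.
case: (gpartP A) => _ _ /(_ a) [m [e [eP ea]]] _.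
have := @graded_parts_uniq k B n m g (fun i => f (e i)) gP (fun j => ghomP f (eP j)).
rewrite -fa ea raddf_sum => /(_ erefl i); rewrite lt_in => ->.
by case: ifP => _; rewrite ?mem_hom_image // -(raddf0 f) mem_hom_image.
Qed.

Definition image_subalg : gradedSubalg B :=
  @GradedSubalg k B (hom_image : subalgClosed B) hom_image_homogeneous.

Definition corestr (x : A) : image_subalg := Subalg (mem_hom_image x : f x \in gsub image_subalg).

Fact corestr_linear : linear corestr.
Proof. by move=> a x y; apply: val_inj; rewrite /= linearP. Qed.

Fact corestr_monoid_morphism : monoid_morphism corestr.
Proof. by split=> [|x y]; apply: val_inj; rewrite /= ?rmorph1 ?rmorphM. Qed.

HB.instance Definition _ := GRing.isLinear.Build k A image_subalg _ corestr corestr_linear.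
HB.instance Definition _ :=
  GRing.isMonoidMorphism.Build A image_subalg corestr corestr_monoid_morphism.

Definition corestr_hom : gradedHom A image_subalg :=
  @GradedHom k A image_subalg (corestr : {lrmorphism A -> image_subalg}) (@ghomP k A B f).

Lemma corestr_surj (y : image_subalg) : exists x, corestr x = y.
Proof. by case: y => b /[dup] /hom_imageP [x fx] bP; exists x; apply: val_inj. Qed.

Section Inverse.
Variable g : B -> A.
Hypotheses (fK : cancel f g) (gK : cancel g f).

Fact can_hom_linear : linear g.
Proof. by move=> a x y; apply: (can_inj fK); rewrite linearP /= !gK. Qed.

Fact can_hom_monoid_morphism : monoid_morphism g.
Proof. by split=> [|x y]; apply: (can_inj fK); rewrite ?rmorph1 ?rmorphM /= !gK ?rmorph1. Qed.

HB.instance Definition _ := GRing.isLinear.Build k B A _ g can_hom_linear.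
HB.instance Definition _ := GRing.isMonoidMorphism.Build B A g can_hom_monoid_morphism.

Definition can_hom : gradedHom B A.
Proof.
refine (@GradedHom k B A (g : {lrmorphism B -> A}) _) => n x xn.
by apply: (inj_hom_part (can_inj fK)); rewrite gK.
Defined.

End Inverse.

(** The inverse preserves degrees because an injective graded map reflects them ([inj_hom_part]). *)
Lemma bij_hom : injective f -> (forall b, exists a, f a = b) ->
  exists g : gradedHom B A, cancel f g /\ cancel g f.
Proof.
move=> f_inj f_surj.
pose g b := projT1 (cid (f_surj b)).
have gK : cancel g f by move=> b; rewrite /g; case: cid.
have fK : cancel f g by move=> a; apply: f_inj; rewrite gK.
by exists (can_hom fK gK).
Qed.

Definition hom_part1 (v : submod (gpart A 1)) : submod (gpart B 1) :=
  Submod (ghomP f (submod_valP v)).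

Fact hom_part1_linear : linear hom_part1.
Proof. by move=> a x y; apply: val_inj; rewrite /= linearP. Qed.

HB.instance Definition _ := GRing.isLinear.Build k _ _ _ hom_part1 hom_part1_linear.

End GradedHom.

(** The condition of [generated_in_degree1] at a single element: it can be pushed along each [phi i]
    although no [phi i] need be onto. *)
Definition deg1_spanned (k : fieldType) (A : gradedAlg k) (x : A) : Prop :=
  exists s : seq (k * seq A),
    (forall w, w \in s -> {subset w.2 <= gpart A 1}) /\
    x = \sum_(w <- s) w.1 *: \prod_(y <- w.2) y.

Lemma hom_deg1_spanned (k : fieldType) (A B : gradedAlg k) (f : gradedHom A B) x :
  deg1_spanned x -> deg1_spanned (f x).
Proof.
move=> [s [sP ->]]; exists [seq (w.1, map f w.2) | w <- s]; split.
  by move=> _ /mapP [w ws ->] _ /mapP [y yw ->]; apply: ghomP; exact: (sP w).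
rewrite raddf_sum big_map; apply: eq_bigr => w _ /=.
by rewrite linearZ rmorph_prod big_map.
Qed.

(** * Invariance under graded isomorphism *)

Section Transport.
Variables (k : fieldType) (A B : gradedAlg k).
Variables (f : gradedHom A B) (g : gradedHom B A).
Hypotheses (fK : cancel f g) (gK : cancel g f).

Lemma connected_iso : connected A -> connected B.
Proof.
move=> A_conn x; split=> [/(ghomP g)/A_conn [c gx]|[c ->]].
  by exists c; rewrite -(gK x) gx linearZ rmorph1.
by rewrite rpredZ //; case: (gpartP B).
Qed.

(** The same [T] serves for [B], since [g] identifies [B_1] with [A_1] linearly. *)
Lemma tensor_algebra_iso (T : gradedAlg k) (iota : {linear submod (gpart A 1) -> T}) :
  is_tensor_algebra iota -> is_tensor_algebra (iota \o hom_part1 g).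
Proof.
have fgK : cancel (hom_part1 g) (hom_part1 f).
  by move=> v; apply: val_inj; rewrite /= gK.
have gfK : cancel (hom_part1 f) (hom_part1 g).
  by move=> v; apply: val_inj; rewrite /= fK.
move=> [iota1 T_univ T_uniq]; split=> [v|C F|C F G FG]; first exact: iota1.
  have [H HE] := T_univ C (F \o hom_part1 f).
  by exists H => v; rewrite /= HE /= fgK.
by apply: T_uniq => v; rewrite -(gfK v); exact: FG.
Qed.

(** The presentation keeps [T] and [R]; following [pi] by the injective map [f] leaves the kernel
    unchanged. *)
Lemma quadratic_iso : quadratic A -> quadratic B.
Proof.
move=> [A_conn A_gen [T [iota [R [pi [T_tens R2 pi_surj pi_ker]]]]]]; split.
- exact: connected_iso A_conn.
- by move=> b; rewrite -(gK b); apply: hom_deg1_spanned; exact: A_gen.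
exists T, (iota \o hom_part1 g), R, (comp_hom f pi); split=> //.
- exact: tensor_algebra_iso T_tens.
- by move=> b; have [t tb] := pi_surj (g b); exists t; rewrite /= tb gK.
move=> t; rewrite -pi_ker; split=> /= [pit|->]; last exact: raddf0.
by apply: (can_inj fK); rewrite raddf0.
Qed.

Lemma finite_type_iso : finite_type A -> finite_type B.
Proof.
move=> [s [s1 sP]]; exists (map f s); split.
  by move=> _ /mapP [y ys ->]; apply: ghomP; exact: s1.
move=> x /(ghomP g)/sP [c gx]; exists c; rewrite -(gK x) gx raddf_sum size_map.
by apply: eq_bigr => i _; rewrite /= linearZ (nth_map 0).
Qed.

Lemma gen1_left_ideal_preim (I : {pred B}) :
  gen1_left_ideal I -> gen1_left_ideal [pred a | f a \in I].
Proof.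
move=> [[I0 ID IM] I_hom I_gen]; split; first split.
- by rewrite inE raddf0.
- by move=> u v; rewrite !inE raddfD; exact: ID.
- by move=> a u; rewrite !inE rmorphM; exact: IM.
- move=> n e eP; rewrite inE raddf_sum => eI i lt_in.
  by apply: (I_hom n (fun i => f (e i)) _ eI i lt_in) => j; exact: ghomP.
move=> x /I_gen [s [sP fx]]; exists [seq (g t.1, g t.2) | t <- s]; split.
  by move=> _ /mapP [t /sP [tI t1] ->] /=; rewrite inE gK; split=> //; exact: ghomP.
rewrite -(fK x) fx raddf_sum big_map.
by apply: eq_bigr => t _; rewrite /= rmorphM.
Qed.

End Transport.

(** An ideal [I] of [B] is pulled back to [A] along [f], its colon ideal by [g x] is formed there,
    and pulling that back along [g] yields [I : x]. *)
Lemma universally_koszul_iso (k : fieldType) (A B : gradedAlg k)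
    (f : gradedHom A B) (g : gradedHom B A) :
  cancel f g -> cancel g f -> universally_koszul A -> universally_koszul B.
Proof.
move=> fK gK A_koszul I I_gen x x1 xI.
have := A_koszul _ (gen1_left_ideal_preim fK gK I_gen) (g x) (ghomP g x1).
rewrite inE gK => /(_ xI)/(gen1_left_ideal_preim gK fK).
congr gen1_left_ideal; apply: funext => b.
by rewrite /= !inE /= rmorphM /= !gK.
Qed.

(** * The images of the algebras of a directed system in its limit *)

Section Limit.
Variables (k : fieldType) (D : directedSystem k).
Hypothesis D_injective : forall (i j : ds_index D) (h : ds_le i j), injective (ds_map h).
Variables (A : gradedAlg k) (phi : forall i : ds_index D, gradedHom (D i) A).
Hypothesis A_limit : is_direct_limit phi.

Let phi_cocone : is_cocone phi := proj1 A_limit.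

(** An element killed by [phi i] dies at a later stage; here the injectivity of the transition maps
    enters. *)
Lemma limit_inj i : injective (phi i).
Proof.
apply: raddf_inj => x /(limit_ker A_limit) [j [h hx]].
by apply: (D_injective (h := h)); rewrite raddf0.
Qed.

Lemma image_subset i j (h : ds_le i j) :
  {subset gsub (image_subalg (phi i)) <= gsub (image_subalg (phi j))}.
Proof. by move=> _ /hom_imageP [x <-]; rewrite -(phi_cocone h) mem_hom_image. Qed.

Lemma image_directed i j : exists l,
  {subset gsub (image_subalg (phi i)) <= gsub (image_subalg (phi l))} /\
  {subset gsub (image_subalg (phi j)) <= gsub (image_subalg (phi l))}.
Proof.
by have [l [h h']] := ds_directed i j; exists l; split; exact: image_subset.
Qed.

(** A cocone on the images restricts to one on the [D i] along the corestrictions of the [phi i];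
    these are onto, so a map compatible with the restricted cocone is compatible with the original
    one. *)
Lemma image_limit : @is_direct_limit k
  (inclusion_system (B := fun i => image_subalg (phi i)) (ds_nonempty D) image_directed) A
  (fun i => sub_inj (image_subalg (phi i))).
Proof.
split=> // C psi psi_cocone.
pose psi' (i : ds_index D) : gradedHom (D i) C := comp_hom (psi i) (corestr_hom (phi i)).
have psi'_cocone : is_cocone psi'.
  move=> i j h x /=; rewrite -(psi_cocone i j (image_subset h)) /=; congr (psi j _).
  by apply: val_inj; rewrite /= phi_cocone.
have [_ /(_ C psi' psi'_cocone) [[u uE] u_uniq]] := A_limit.
split; first by exists u => i y; have [x <-] := corestr_surj y; exact: uE.
by move=> v w vE wE; apply: u_uniq => i x;
  [exact: (vE i (corestr (phi i) x)) | exact: (wE i (corestr (phi i) x))].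
Qed.

Lemma image_iso i : exists g : gradedHom (image_subalg (phi i)) (D i),
  cancel (corestr_hom (phi i)) g /\ cancel g (corestr_hom (phi i)).
Proof.
apply: bij_hom; last exact: corestr_surj.
by move=> x y /(congr1 val)/limit_inj.
Qed.

(** Injective graded maps reflect degrees, so a degree 0 element of [A] comes from degree 0 of some
    [D i], where it is a scalar. *)
Lemma limit_connected : (forall i, connected (D i)) -> connected A.
Proof.
move=> D_conn a; split=> [|[c ->]]; last by rewrite rpredZ //; case: (gpartP A).
have [i [x <-]] := limit_surj A_limit a.
move=> /(inj_hom_part (@limit_inj i))/D_conn [c ->].
by exists c; rewrite linearZ rmorph1.
Qed.

Lemma finite_family_image (s : seq A) :
  exists j, {subset s <= gsub (image_subalg (phi j))}.
Proof.
elim: s => [|a s [j sj]]; first by have [j _] := ds_nonempty D; exists j.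
have [i [x <-]] := limit_surj A_limit a; have [l [h h']] := image_directed i j.
exists l => y; rewrite inE => /predU1P [->|/sj/h'//].
by apply: h; exact: mem_hom_image.
Qed.

End Limit.

Theorem proposition3p2 (k : fieldType) (D : directedSystem k)
    (D_injective : forall (i j : ds_index D) (h : ds_le i j), injective (ds_map h))
    (D_quadratic : forall i : ds_index D, quadratic (D i))
    (D_finite_type : forall i : ds_index D, finite_type (D i))
    (D_koszul : forall i : ds_index D, universally_koszul (D i))
    (A : gradedAlg k) (phi : forall i : ds_index D, gradedHom (D i) A)
    (A_limit : is_direct_limit phi) :
  asymptotically_universally_koszul A.
Proof.
split.
- by apply: (limit_connected D_injective A_limit) => i; case: (D_quadratic i).
- move=> a; have [i [x <-]] := limit_surj A_limit a; apply: hom_deg1_spanned.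
  by case: (D_quadratic i) => _ /(_ x).
exists (ds_index D), (fun i => image_subalg (phi i)), (ds_nonempty D).
exists (image_directed A_limit); split.
- move=> i; have [g [fK gK]] := image_iso D_injective A_limit i.
  by split; [exact: (quadratic_iso fK gK) | exact: (finite_type_iso gK)].
- move=> i; have [g [fK gK]] := image_iso D_injective A_limit i.
  exact: (universally_koszul_iso fK gK).
- exact: image_limit.
(* An image containing the spanning family [s] contains all of [W], being a subspace. *)
move=> W [s [sW W_span]] W1; have [j sj] := finite_family_image A_limit s.
exists j => x xW.
have xj : x \in gsub (image_subalg (phi j)).
  have [c ->] := W_span x xW; apply: rpred_sum => i _.
  by apply: rpredZ; apply: sj; exact: mem_nth.
(* Degrees in the image are those of [A], so [W1] applies as it stands. *)
by exists (Subalg xj); [exact: W1|].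
Qed.
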